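(* Let $\Omega\subset\mathbb{C}^n$ be a B-regular domain. A positive Radon measure $\mu$ on $\bar\Omega$ is minimal with respect to $\le_{\mathrm{c}}$ if and only if $\operatorname{supp}\mu\subset\partial\Omega$.
   Context: $\mathcal{PSH}(\Omega)$ is the set of plurisubharmonic functions on $\Omega$. A bounded domain $\Omega\subset\mathbb{C}^n$ is B-regular if every $\phi\in C(\partial\Omega)$ extends to a function in $\mathcal{PSH}(\Omega)\cap C(\bar\Omega)$. For finite positive Radon measures $\mu,\nu$ on $\bar\Omega$, write $\mu\le_{\mathrm{c}}\nu$ if $\int u\,d\mu\ge\int u\,d\nu$ for all $u\in\mathcal{PSH}(\Omega)\cap C(\bar\Omega)$ (note the reversal of the inequality). A positive Radon measure $\mu$ on $\bar\Omega$ is minimal with respect to $\le_{\mathrm{c}}$ if $\nu\le_{\mathrm{c}}\mu$ implies $\nu=\mu$. *)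

(* Defs.v *)
From HB Require Import structures.
From mathcomp Require Import all_boot all_order all_algebra.
From mathcomp Require Import all_classical all_reals all_analysis.
From mathcomp Require Import complex.

Set Implicit Arguments.
Unset Strict Implicit.
Unset Printing Implicit Defensive.

Import Order.TTheory GRing.Theory Num.Theory.
Import numFieldNormedType.Exports.

Local Open Scope classical_set_scope.
Local Open Scope ring_scope.

(* C is R[i] for R : realType, and C^n is 'rV[R[i]]_n.
   The norm topology of the numeric field R[i]; the library only registers it
   on variables of type numFieldType (and on R[i]^o). *)
HB.instance Definition _ (R : realType) :=
  PseudoPointedMetric.copy R[i] (R[i]^o).
HB.instance Definition _ (R : realType) := NormedModule.copy R[i] (R[i]^o).

Section topology.
Context {T : topologicalType} {R : realType}.

Definition boundary (A : set T) : set T := closure A `\` interior A.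

Definition usc_on (D : set T) (f : T -> \bar R) : Prop :=
  forall x, D x -> forall a : \bar R, (f x < a)%E ->
    \forall y \near within D (nbhs x), (f y < a)%E.

End topology.

Section plurisubharmonic.
Context {R : realType}.

Definition circle_mean (v : R[i] -> \bar R) (a : R[i]) (r : R) : \bar R :=
  (((2 * pi)^-1)%:E * \int[lebesgue_measure]_(t in `[0%R, (2 * pi)%R]%classic)
     v (a + r%:C%C * (cos t +i* sin t)%C)%R)%E.

(* Values in [-oo, +oo[; the constant -oo is allowed, so that restrictions of
   a plurisubharmonic function to complex lines are covered. *)
Definition subharmonic (D : set R[i]) (v : R[i] -> \bar R) : Prop :=
  [/\ forall z, D z -> (v z < +oo)%E,
      usc_on D v &
      forall (a : R[i]) (r : R), 0 < r ->
        [set z | `|z - a| <= r%:C%C] `<=` D -> (v a <= circle_mean v a r)%E].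

Definition psh n (Omega : set 'rV[R[i]]_n) (u : 'rV[R[i]]_n -> \bar R) : Prop :=
  [/\ forall z, Omega z -> (u z < +oo)%E,
      usc_on Omega u &
      forall a b : 'rV[R[i]]_n,
        subharmonic [set l | Omega (a + l *: b)] (fun l => u (a + l *: b))].

(* PSH(Omega) /\ C(closure Omega): only the values of u on closure Omega
   matter. *)
Definition psh_continuous n (Omega : set 'rV[R[i]]_n) (u : 'rV[R[i]]_n -> R) :
  Prop := psh Omega (EFin \o u) /\ {within closure Omega, continuous u}.

Definition domain n (Omega : set 'rV[R[i]]_n) : Prop :=
  [/\ Omega !=set0, open Omega & connected Omega].

Definition B_regular n (Omega : set 'rV[R[i]]_n) : Prop :=
  [/\ domain Omega, bounded_set Omega &
      forall phi : 'rV[R[i]]_n -> R, {within boundary Omega, continuous phi} ->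
        exists2 u, psh_continuous Omega u &
          forall z, boundary Omega z -> u z = phi z].

End plurisubharmonic.

(* C^n with its Borel sigma-algebra. *)
Definition borelCn (R : realType) (n : nat) :=
  g_sigma_algebraType (@open 'rV[R[i]]_n).

Section measures.
Context {R : realType} {n : nat}.
Implicit Types mu nu : {measure set (borelCn R n) -> \bar R}.

(* Positive Radon measures on a closed set X of C^n, encoded as the Radon
   measures on C^n that vanish outside X. *)
Definition radon_on (X : set 'rV[R[i]]_n) mu : Prop :=
  [/\ mu (~` X) = 0%E,
      forall K : set 'rV[R[i]]_n, compact K -> (mu K < +oo)%E &
      forall A : set (borelCn R n), measurable A ->
        mu A = ereal_sup [set mu K | K in
          [set K : set 'rV[R[i]]_n | compact K /\ K `<=` A]]].

Definition msupport mu : set 'rV[R[i]]_n :=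
  [set z | forall U : set 'rV[R[i]]_n, open U -> U z -> (0 < mu U)%E].

(* le_c Omega mu nu is mu <=_c nu: mu has the larger integrals. *)
Definition le_c (Omega : set 'rV[R[i]]_n) mu nu : Prop :=
  forall u : 'rV[R[i]]_n -> R, psh_continuous Omega u ->
    (\int[mu]_(z in closure Omega) (u z)%:E >=
     \int[nu]_(z in closure Omega) (u z)%:E)%E.

(* Equality of measures is equality on Borel sets: the library leaves the
   values of a measure on non-measurable sets unconstrained. *)
Definition minimal_c (Omega : set 'rV[R[i]]_n) mu : Prop :=
  forall nu, radon_on (closure Omega) nu -> le_c Omega nu mu ->
    forall A : set (borelCn R n), measurable A -> nu A = mu A.

End measures.

(* Main.v *)
Require Import Defs.
From HB Require Import structures.
From mathcomp Require Import all_boot all_order all_algebra.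
From mathcomp Require Import finmap.
From mathcomp Require Import all_classical all_reals all_analysis.
From mathcomp Require Import complex.
From mathcomp Require Import measurable_realfun ring lra.
Import Order.TTheory GRing.Theory Num.Theory.
Import numFieldNormedType.Exports.
Local Open Scope classical_set_scope.
Local Open Scope ring_scope.

(* If the support of mu meets Omega at z, spread the part of mu near z over
   circles of fixed radius in a complex line: by the submean inequality and
   Fubini the resulting measure is below mu, and when the radius is twice that
   of the neighbourhood it no longer charges the neighbourhood, so mu is not
   minimal.  Conversely, let mu live on the boundary and nu <=_c mu.  Extending
   - |z_0|^2 from the boundary to a psh function u, the psh function
   u + |z_0|^2 vanishes on the boundary and is negative inside by the strict
   maximum principle, which forces nu(Omega) = 0.  Testing with psh extensions
   of f and - f then gives equal integrals of every continuous f over the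
   boundary, hence nu = mu by regularity. *)

(** * Norms over the complex field as real numbers *)

Section complex_norm.
Context {R : realType} {V : pseudoMetricNormedZmodType R[i]}.
Implicit Types x y : V.

(** The norm over [R[i]] is an element of [R[i]] with zero imaginary part; its real part is the same
    number in the ordered field [R], where infima and linear arithmetic apply. *)
Definition rnorm x : R := complex.Re `|x|.

Lemma rnormE x : `|x| = (rnorm x)%:C%C.
Proof. by rewrite /rnorm RRe_real// normr_real. Qed.

Lemma rnorm_ge0 x : 0 <= rnorm x.
Proof. by rewrite -ler0c -rnormE. Qed.

Lemma rnorm_triangle x y : rnorm (x + y) <= rnorm x + rnorm y.
Proof. by rewrite -lecR rmorphD/= -!rnormE ler_normD. Qed.

Lemma rnormN x : rnorm (- x) = rnorm x.
Proof. by rewrite /rnorm normrN. Qed.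

Lemma rnormB x y : rnorm (x - y) = rnorm (y - x).
Proof. by rewrite /rnorm distrC. Qed.

Lemma rnorm_dist x y z : rnorm (x - z) <= rnorm (x - y) + rnorm (y - z).
Proof. by apply: le_trans (rnorm_triangle _ _); rewrite addrA subrK. Qed.

Lemma nbhs_rnormP x (A : set V) :
  nbhs x A <-> exists2 e : R, 0 < e & forall y, rnorm (x - y) < e -> A y.
Proof.
split=> [/nbhs_normP[e /= e0 eA]|[e e0 eA]].
  have er : e = (complex.Re e)%:C%C by rewrite RRe_real// gtr0_real.
  exists (complex.Re e); first by rewrite -ltcR -er.
  by move=> y xy; apply: eA; rewrite /ball_/= er rnormE ltcR.
apply/nbhs_normP; exists e%:C%C; first by rewrite /= ltcR.
by move=> y; rewrite /ball_/= rnormE ltcR; exact: eA.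
Qed.

Lemma continuous_rnorm_le (f : V -> R) :
  (forall x y, `|f x - f y| <= rnorm (x - y)) -> continuous f.
Proof.
move=> fP x; apply/cvgrPdist_lt => e e0; apply/nbhs_rnormP.
by exists e => // y; exact: le_lt_trans.
Qed.

End complex_norm.

(** The functional form of perfect normality. The measurability and regularity results below start
    from this property instead of a metric. *)
Definition perfectly_normal (R : realType) (T : topologicalType) :=
  forall K : set T, closed K ->
    exists f : T -> R,
      [/\ continuous f, forall x, 0 <= f x & forall x, f x = 0 <-> K x].

(** The distance to [K] is 1-Lipschitz, and it vanishes only on [K] because [K] is closed. *)
Lemma perfectly_normal_complex (R : realType)
  (V : pseudoMetricNormedZmodType R[i]) : perfectly_normal R V.
Proof.
(* The empty set is treated apart: the infimum of the empty set is the default value 0, whose zero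
   set would be the whole space. *)
move=> K cK; have [->|/set0P[k Kk]] := eqVneq K set0.
  exists (cst 1); split=> // x; first exact: cst_continuous.
  by split=> // /eqP; rewrite oner_eq0.
pose D x := [set rnorm (x - y) | y in K].
have Dlb x : lbound (D x) 0 by move=> _ [y _ <-]; exact: rnorm_ge0.
have Dinf x : has_inf (D x).
  by split; [exists (rnorm (x - k)), k|exists 0; exact: Dlb].
have Dle x y : K y -> inf (D x) <= rnorm (x - y).
  by move=> Ky; apply: ge_inf; [exists 0; exact: Dlb|exists y].
have Dlip x y : inf (D x) - inf (D y) <= rnorm (x - y).
  rewrite lerBlDl -lerBlDr; apply: lb_le_inf; first by case: (Dinf y).
  move=> _ [z Kz <-]; rewrite lerBlDr addrC.
  exact: le_trans (Dle _ _ Kz) (rnorm_dist _ _ _).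
exists (fun x => inf (D x)); split.
- apply: continuous_rnorm_le => x y; rewrite ler_norml Dlip andbT lerNl opprB.
  by rewrite rnormB Dlip.
- by move=> x; apply: lb_le_inf; [case: (Dinf x)|exact: Dlb].
- move=> x; split=> [x0|Kx]; last first.
    apply/eqP; rewrite eq_le lb_le_inf ?andbT; [|by case: (Dinf x)|exact: Dlb].
    by apply: le_trans (Dle _ _ Kx) _; rewrite subrr /rnorm normr0.
  apply: cK => B /nbhs_rnormP[e e0 eB].
  have [|_ [z Kz <-] xze] := @inf_adherent _ (D x) e e0; first exact: Dinf.
  by exists z; split=> //; apply: eB; rewrite x0 add0r in xze.
Qed.

(** * Borel measurability *)

Section borel.
Context {R : realType} {T : ptopologicalType}.
Local Notation borelT := (g_sigma_algebraType (@open T)).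

Lemma open_borel (U : set borelT) : open (U : set T) -> measurable U.
Proof. exact: sub_sigma_algebra. Qed.

Lemma closed_borel (F : set borelT) : closed (F : set T) -> measurable F.
Proof.
move=> cF; rewrite -(setCK F); apply: measurableC; apply: open_borel.
exact: (@closed_openC T).
Qed.

Lemma continuous_within_borel (D : set borelT) (f : borelT -> R) :
  measurable D -> {within (D : set T), continuous (f : T -> R)} ->
  measurable_fun D f.
Proof.
move=> mD /continuousP cf.
apply: (measurability _ (RGenOInfty.measurableE R)) => _ [_ [x ->] <-].
have /open_subspaceP[V oV VD] := cf _ (@interval_open _ (BRight x) +oo%O isT isT).
by rewrite setIC -VD; apply: measurableI => //; exact: open_borel.
Qed.

(* A function measurable in [x] and continuous in [t] maps [(x, t)] into the
   open set [0 < g] iff it maps [(x, q)] into [1/m <= g] for all rationals [q]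
   close enough to [t]. *)
Lemma caratheodory_measurable d (X : measurableType d) (h : X -> R -> borelT) :
  perfectly_normal R T ->
  (forall t, measurable_fun setT (h ^~ t)) ->
  (forall x, continuous (h x : R -> T)) ->
  measurable_fun setT (fun p : X * R => h p.1 p.2).
Proof.
move=> pT mh ch; apply: (@measurability _ _ _ borelT _ _ (@open T) erefl) => _ [U oU <-].
rewrite setTI.
have [g [cg g0 gU]] := pT _ (open_closedC oU).
have mg : measurable_fun setT (g : borelT -> R).
  by apply: continuous_within_borel => //; exact: continuous_subspaceT.
have gUP y : U y <-> 0 < g y.
  rewrite lt_def g0 andbT; split=> [Uy|/eqP gy]; first by apply/eqP => /gU.
  by apply: contrapT => /gU.
(* The implication from [|q - t| < 1/(k+1)] to [1/(m+1) <= g] is written as a union of two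
   measurable sets; [q] being rational, only countable operations remain. *)
pose E m k q := [set p : X * R | k.+1%:R^-1 <= `|ratr q - p.2|] `|`
  [set p : X * R | m.+1%:R^-1 <= g (h p.1 (ratr q))].
rewrite [X in measurable X](_ : _ = \bigcup_m \bigcup_k \bigcap_(q : rat) E m k q).
  apply: bigcupT_measurable => m; apply: bigcupT_measurable => k.
  rewrite -[X in measurable X]setCK setC_bigcap; apply/measurableC/bigcupT_measurable_rat => q.
  apply/measurableC/measurableU.
    have mF : measurable_fun setT (fun p : X * R => `|ratr q - p.2|).
      apply: measurableT_comp => //; apply: measurable_funD => //.
      by exact: measurableT_comp.
    rewrite -[X in measurable X]setTI.
    have := mF measurableT `[k.+1%:R^-1, +oo[%classic (measurable_itv _).
    by congr (measurable (_ `&` _)); apply/seteqP; split=> p /=; rewrite in_itv/= andbT.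
  have mF : measurable_fun setT (fun p : X * R => g (h p.1 (ratr q))).
    apply: (measurableT_comp mg (measurableT_comp (mh _) _)).
    exact: measurable_fst.
  rewrite -[X in measurable X]setTI.
  have := mF measurableT `[m.+1%:R^-1, +oo[%classic (measurable_itv _).
  by congr (measurable (_ `&` _)); apply/seteqP; split=> p /=; rewrite in_itv/= andbT.
apply/seteqP; split=> [[x t]/= Uxt|[x t]/= [m _ [k _ Emk]]].
  have ghxt : 0 < g (h x t) by apply/gUP.
  have [m mgx] : exists m, m.+1%:R^-1 < g (h x t).
    by exists (Num.truncn (g (h x t))^-1); rewrite invf_plt ?posrE// truncnS_gt.
  have cgh : continuous (fun t => g (h x t)).
    by move=> s; apply: continuous_comp; [exact: ch|exact: cg].
  have /cvgrPdist_lt/(_ (g (h x t) - m.+1%:R^-1)) := cgh t.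
  rewrite subr_gt0 => /(_ mgx)/nbhs_ballP[e /= e0 et].
  exists m => //; exists (Num.truncn e^-1) => // q _ /=.
  have [|qt] := leP (Num.truncn e^-1).+1%:R^-1 `|ratr q - t|; [by left|right].
  have : ball t e (ratr q).
    rewrite /ball/= distrC (lt_trans qt)// invf_plt ?posrE// truncnS_gt//.
  move=> /et; rewrite /= => /(le_lt_trans (ler_norm _)).
  by rewrite ltrD2l ltrN2 => /ltW.
apply/gUP; rewrite (@lt_le_trans _ _ m.+1%:R^-1)//; apply/ler_addgt0Pl => e e0.
have cgh : continuous (fun t => g (h x t)).
  by move=> s; apply: continuous_comp; [exact: ch|exact: cg].
have /cvgrPdist_lt/(_ e e0)/nbhs_ballP[d' /= d0 dt] := cgh t.
(* Being within [1/(k+1)] of [t] rules out the first alternative of [E] for [q]; being within [d']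
   makes the values of [g] at [h x t] and at [h x (ratr q)] differ by less than [e]. *)
have [|q] := @rat_in_itvoo R t (t + Num.min d' k.+1%:R^-1).
  by rewrite ltrDl lt_min d0/=.
rewrite in_itv/= => /andP[tq]; rewrite -ltrBlDl lt_min => /andP[qd qk].
have [/=|/= mq] := Emk q I.
  by rewrite gtr0_norm ?subr_gt0// leNgt qk.
have : ball t d' (ratr q) by rewrite /ball/= distrC gtr0_norm ?subr_gt0.
move=> /dt /= ; rewrite distrC => /(le_lt_trans (ler_norm _)).
rewrite ltrBlDr => /ltW; exact: le_trans.
Qed.
End borel.

(** * Finite Borel measures *)

Section regularity.
Context {R : realType} {T : ptopologicalType}.
Local Notation borelT := (g_sigma_algebraType (@open T)).
Implicit Types mu nu : {measure set borelT -> \bar R}.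
Hypothesis pT : perfectly_normal R T.

Let open_sublevel (g : T -> R) (c : R) :
  continuous g -> open [set x | g x < c].
Proof. by move=> /continuousP/(_ [set y | y < c]); apply; exact: open_lt. Qed.

(** Continuity from above: the values [nu (D k)] converge to the measure of the intersection, so a
    strict upper bound is met at a finite stage. *)
Lemma lt_measure_bigcap d (X : measurableType d)
    (nu : {measure set X -> \bar R}) (D : nat -> set X) (a : \bar R) :
  (nu setT < +oo)%E -> (forall k, measurable (D k)) ->
  {homo D : n m / (n <= m)%N >-> (m <= n)%O} ->
  (nu (\bigcap_k D k) < a)%E -> exists k, (nu (D k) < a)%E.
Proof.
move=> nuT mD dD Da.
have mcap : measurable (\bigcap_k D k) by exact: bigcapT_measurable.
have nu0 : (nu (D 0%N) < +oo)%E.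
  by apply: le_lt_trans nuT; rewrite le_measure ?inE.
have /(_ [set y | (y < a)%E]) := nonincreasing_cvg_mu nu0 mD mcap dD.
case; first by apply: open_nbhs_nbhs; split => //; exact: open_ereal_lt_ereal.
by move=> k _ kP; exists k; apply: (kP k) => /=.
Qed.

(** The sets with this approximation property form a sigma-algebra [S]. It contains the open sets,
    hence all Borel sets. *)
Lemma finite_borel_regular nu : (nu setT < +oo)%E ->
  forall A : set borelT, measurable A -> forall e : R, 0 < e ->
  exists F G : set T,
    [/\ closed F, open G, F `<=` A, A `<=` G & (nu (G `\` F) < e%:E)%E].
Proof.
move=> nuT.
pose S := [set A : set T | forall e : R, 0 < e -> exists F G : set T,
  [/\ closed F, open G, F `<=` A, A `<=` G & (nu (G `\` F) < e%:E)%E]].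
suff : @measurable _ borelT `<=` S by [].
apply: smallest_sub; first split.
- move=> e e0; exists set0, set0; split; rewrite ?set0D ?measure0 ?lte_fin//.
    exact: closed0.
  exact: open0.
- move=> A SA e e0; have [F [G [cF oG FA AG FG]]] := SA e e0.
  exists (~` G), (~` F); split.
  + exact: open_closedC.
  + exact: closed_openC.
  + by move=> x /= Gx; split=> // /AG.
  + by move=> x [_ Ax] /FA.
  + by rewrite setDE setCK setIC -setDE.
- move=> A SA e e0.
  (* These tolerances sum to [e / 2], which leaves room for the strict bound by [e]. *)
  have eV i : 0 < e / 2 / (2 ^ i.+1)%:R by rewrite divr_gt0// ?divr_gt0// ltr0n expn_gt0.
  have /choice[F /choice[G FG]] : forall i, exists F, exists G : set T,
      [/\ closed F, open G, F `<=` A i, A i `<=` G &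
        (nu (G `\` F) < (e / 2 / (2 ^ i.+1)%:R)%:E)%E] by move=> i; exact: SA.
  have mF i : measurable (F i : set borelT).
    by case: (FG i) => cF _ _ _ _; exact: closed_borel.
  have mG i : measurable (G i : set borelT).
    by case: (FG i) => _ oG _ _ _; exact: open_borel.
  have mGF : measurable ((\bigcup_k G k : set borelT) `\` \bigcup_k F k).
    by apply: measurableD; exact: bigcupT_measurable.
  (* The union of all [F i] need not be closed, so continuity from above is used to replace it by a
     finite union. *)
  have [|||k Dk] := @lt_measure_bigcap _ _ nu
      (fun N => (\bigcup_i G i : set borelT) `\` \bigcup_(i < N) F i) e%:E nuT.
  + move=> k; apply: measurableD; first exact: bigcupT_measurable.
    by apply: bigcup_measurable.
  + move=> m k mk; apply/subsetPset; apply: setDS => x [i /= im Fx].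
    by exists i => //=; exact: leq_trans mk.
  + apply: (@le_lt_trans _ _ (nu ((\bigcup_k G k : set borelT) `\` \bigcup_k F k))).
      apply: le_measure; rewrite ?inE//.
        apply: bigcapT_measurable => k; apply: measurableD; first exact: bigcupT_measurable.
        by apply: bigcup_measurable.
      move=> x capx; split; first by case: (capx 0%N I).
      by case=> k _ Fx; case: (capx k.+1 I) => _; apply; exists k => /=.
    apply: (@le_lt_trans _ _ (\sum_(i <oo) (nu (G i `\` F i)))%E).
      apply: measure_sigma_subadditive => //; first by move=> i; exact: measurableD.
      move=> x [[i _ Gx] Fx]; exists i => //; split=> // Fix.
      by apply: Fx; exists i.
    apply: (@le_lt_trans _ _ (e / 2)%:E); last by rewrite lte_fin ltr_pdivrMr// ltr_pMr// ltr1n.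
    apply: (@le_trans _ _ (\sum_(i <oo) (0 + (e / 2 / (2 ^ i.+1)%:R)%:E))%E).
      by apply: lee_nneseries => // i _; rewrite add0e; case: (FG i) => _ _ _ _ /ltW.
    have e20 : 0 <= e / 2 by rewrite divr_ge0// ltW.
    apply: le_trans (epsilon_trick xpredT (fun=> lexx _) e20) _.
    by rewrite eseries0// add0e.
  + exists (\bigcup_(i < k) F i), (\bigcup_i G i); split=> //.
    * by apply: closed_bigcup => // i _; case: (FG i).
    * by apply: bigcup_open => i _; case: (FG i).
    * by move=> x [i /= _ Fx]; exists i => //; case: (FG i) => _ _ + _ _; apply.
    * by move=> x [i /= _ Fx]; exists i => //; case: (FG i) => _ _ _ + _; apply.
- move=> U oU e e0.
  have [g [cg g0 gU]] := pT _ (open_closedC oU).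
  (* The closed sets [1/(k+1) <= g] exhaust [U] from inside; the remainders [D k] decrease to the
     empty set because [g] is positive on [U]. *)
  pose D k : set borelT := U `&` [set x | g x < k.+1%:R^-1].
  have oD k : open (D k : set T).
    by apply: openI => //; exact: open_sublevel.
  have mD k : measurable (D k) by exact: open_borel.
  have [||k Dk] := @lt_measure_bigcap _ _ nu D e%:E nuT mD.
  + move=> m k mk; apply/subsetPset; apply: setIS => x /= /lt_le_trans; apply.
    by rewrite lef_pV2 ?posrE// ler_nat.
  + rewrite (_ : \bigcap_k _ = set0) ?measure0//.
    apply/seteqP; split=> // x capx; have [Ux _] := capx 0%N I.
    have gx : 0 < g x.
      by rewrite lt_def g0 andbT; apply/eqP => /gU; apply.
    have [_ /=] := capx (Num.truncn (g x)^-1) I.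
    by rewrite ltNge => /negP; apply; rewrite ltW// invf_plt ?posrE// truncnS_gt.
  + exists (U `\` D k), U; split=> //.
    * rewrite (_ : _ `\` _ = [set x | k.+1%:R^-1 <= g x]).
        by move/continuous_closedP : cg => /(_ [set y | _ <= y]); apply; exact: closed_ge.
      apply/seteqP; split=> [x [Ux Dx]/=|x /= gx].
        by rewrite leNgt; apply/negP => gx; apply: Dx.
      split; last by case=> _ /=; rewrite ltNge gx.
      apply: contrapT => /gU gx0; move: gx; rewrite gx0.
      by rewrite leNgt invr_gt0 ltr0n.
    * have -> : U `\` (U `\` D k) = D k by rewrite setDDr setDv set0U setIidr// => x [].
      exact: Dk.
Qed.

(** A closed set approximating [A] from inside becomes compact when cut with [X], and the cut costs
    nothing since [nu] vanishes off [X]. *)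
Lemma finite_borel_inner_regular nu (X : set T) : hausdorff_space T ->
  compact X -> (nu setT < +oo)%E -> nu (~` X) = 0%E ->
  forall A : set borelT, measurable A ->
    nu A = ereal_sup [set nu K | K in [set K : set T | compact K /\ K `<=` A]].
Proof.
move=> hT cX nuT nuX A mA; apply/eqP; rewrite eq_le; apply/andP; split; last first.
  apply: ge_ereal_sup => _ [K [cK KA] <-]; apply: le_measure; rewrite ?inE//.
  by apply: closed_borel; exact: compact_closed.
apply/lee_addgt0Pr => e e0.
have [F [G [cF oG FA AG FG]]] := finite_borel_regular nu nuT A mA e e0.
have mX : measurable (X : set borelT) by apply: closed_borel; exact: compact_closed.
have mF : measurable (F : set borelT) by exact: closed_borel.
have mG : measurable (G : set borelT) by exact: open_borel.
have cK : compact (F `&` X) by rewrite setIC; apply: compact_closedI.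
apply: (@le_trans _ _ (nu (F `&` X) + e%:E)%E); last first.
  by rewrite leeD2r//; apply: ereal_sup_ubound; exists (F `&` X) => //; split => // x [/FA].
have FX0 : nu ((F : set borelT) `\` X) = 0%E.
  apply: (@subset_measure0 _ _ _ nu _ (~` X)) => //.
  - exact: measurableD.
  - exact: measurableC.
have -> : nu (F `&` X) = nu F.
  transitivity (nu ((F : set borelT) `\` X) + nu ((F : set borelT) `&` X))%E.
    by rewrite FX0 add0e.
  by apply/esym; exact: measureDI.
have -> : nu A = (nu (A `\` F) + nu (A `&` F))%E by exact: measureDI.
rewrite [A `&` F]setIidr// addeC leeD2l//.
apply/ltW/(le_lt_trans _ FG); apply: le_measure; rewrite ?inE; try exact: measurableD.
exact: setSD.
Qed.

(* [max(0, 1 - (k + 1) g)] decreases to the indicator of the zero set of [g]. *)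
Lemma le_measure_closed mu nu (D F : set borelT) : (nu setT < +oo)%E ->
  measurable D -> closed (F : set T) -> F `<=` D ->
  (forall f : T -> R, continuous f -> (forall x, 0 <= f x) ->
    (\int[mu]_(x in D) (f x)%:E <= \int[nu]_(x in D) (f x)%:E)%E) ->
  (mu F <= nu F)%E.
Proof.
move=> nuT mD cF FD le_f; rewrite leNgt; apply/negP => nuF.
have mF : measurable F by exact: closed_borel.
have [g [cg g0 gF]] := pT _ cF.
pose E k : set borelT := D `&` [set x | g x < k.+1%:R^-1].
have mE k : measurable (E k).
  apply: measurableI => //; apply: open_borel.
  exact: open_sublevel.
have [||k] := @lt_measure_bigcap _ _ nu E (mu F) nuT mE.
- move=> m k mk; apply/subsetPset; apply: setIS => x /= /lt_le_trans; apply.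
  by rewrite lef_pV2 ?posrE// ler_nat.
- rewrite (_ : \bigcap_k _ = F)//; apply/seteqP; split=> [x capx|x Fx k _].
    apply/gF; apply: contrapT => /eqP gx.
    have {}gx : 0 < g x by rewrite lt_def gx g0.
    have [_ /=] := capx (Num.truncn (g x)^-1) I.
    by rewrite ltNge => /negP; apply; rewrite ltW// invf_plt ?posrE// truncnS_gt.
  by split; [exact: FD|rewrite /= (gF x).2// invr_gt0 ltr0n].
apply/negP; rewrite -leNgt.
(* On [D], [f] lies between the indicators of [F] and of [E k]. Hence [mu F <= nu (E k)], against
   the choice of [k]. *)
pose f x : R := Num.max 0 (1 - k.+1%:R * g x).
have cf : continuous f.
  move=> x; apply: (@continuous_max R T (cst 0) (fun x => 1 - k.+1%:R * g x)); first exact: cvg_cst.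
  by apply: cvgB; [exact: cvg_cst|apply: cvgM; [exact: cvg_cst|exact: cg]].
have f0 x : 0 <= f x by rewrite le_max lexx.
have mf : measurable_fun D (EFin \o (f : borelT -> R)).
  apply/measurable_EFinP; apply: continuous_within_borel => //.
  exact: continuous_subspaceT.
have indic_le (m : {measure set borelT -> \bar R}) (A : set borelT) :
    measurable A -> A `<=` D -> m A = (\int[m]_(x in D) (\1_A x)%:E)%E.
  by move=> mA AD; rewrite integral_indic// setIidl.
apply: (@le_trans _ _ (\int[mu]_(x in D) (f x)%:E)%E).
  rewrite (indic_le mu F)//; apply: ge0_le_integral => //.
  - by apply/measurable_EFinP/measurable_funTS/measurable_indic.
  - move=> x _; rewrite lee_fin indicE; have [/set_mem Fx|_] := boolP (x \in F); last by rewrite f0.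
    by rewrite /f (gF x).2// mulr0 subr0 le_max lexx orbT.
apply: le_trans (le_f f cf f0) _.
rewrite (indic_le nu (E k))//; last by move=> x [].
apply: ge0_le_integral => //.
- by move=> x _; rewrite lee_fin f0.
- by apply/measurable_EFinP/measurable_funTS/measurable_indic.
- move=> x Dx; rewrite lee_fin indicE; have [_|Ex] := boolP (x \in E k).
    by rewrite ge_max ler01 lerBlDr lerDl mulr_ge0.
  rewrite /f ge_max lexx/= subr_le0.
  rewrite mulrC -ler_pdivrMr ?ltr0n// div1r leNgt; apply/negP => gx.
  by move/negP: Ex; apply; rewrite inE; split.
Qed.

End regularity.

(** * Circles in the complex plane *)

Section complex_plane.
Context {R : realType}.
Implicit Types (z w : R[i]) (r t : R).

Lemma cvg_rnorm {T : topologicalType} {V : pseudoMetricNormedZmodType R[i]}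
    (f : T -> V) x :
  (forall e : R, 0 < e -> \forall y \near x, rnorm (f x - f y) < e) ->
  {for x, continuous f}.
Proof.
move=> fx A /nbhs_rnormP[e e0 eA]; near_simpl.
by near=> y; apply: eA; near: y; exact: fx.
Unshelve. all: by end_near. Qed.

Lemma rnorm_sqr z : rnorm z ^+ 2 = complex.Re z ^+ 2 + complex.Im z ^+ 2.
Proof. by rewrite /rnorm normc_def/= sqr_sqrtr// addr_ge0// sqr_ge0. Qed.

Lemma rnorm_cartesian (a b : R) : rnorm (a +i* b)%C <= `|a| + `|b|.
Proof.
rewrite -ler_sqr ?nnegrE ?rnorm_ge0 ?addr_ge0// rnorm_sqr/=.
rewrite sqrrD !real_normK ?num_real// addrAC lerDl.
by rewrite mulrn_wge0// mulr_ge0.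
Qed.

Lemma continuous_cartesian : continuous (fun p : R * R => (p.1 +i* p.2)%C).
Proof.
move=> [a b]; apply: cvg_rnorm => e e0.
have e2 : 0 < e / 2 by rewrite divr_gt0.
have /cvgrPdist_lt/(_ _ e2) c1 : (fun q : R * R => q.1) @ (a, b) --> a.
  exact: cvg_fst.
have /cvgrPdist_lt/(_ _ e2) c2 : (fun q : R * R => q.2) @ (a, b) --> b.
  exact: cvg_snd.
near=> q.
apply: (@le_lt_trans _ _ (`|a - q.1| + `|b - q.2|)).
  exact: rnorm_cartesian.
by rewrite [ltRHS]splitr ltrD//; near: q.
Unshelve. all: by end_near. Qed.

Definition circle r t : R[i] := r%:C%C * (cos t +i* sin t)%C.

Lemma rnorm_circle r t : 0 <= r -> rnorm (circle r t) = r.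
Proof.
move=> r0; apply/eqP; rewrite -(@eqrXn2 _ 2) ?rnorm_ge0// rnorm_sqr/=.
rewrite !mul0r subr0 addr0 !exprMn -mulrDr cos2Dsin2 mulr1//.
Qed.

Lemma continuous_circle r : continuous (circle r).
Proof.
move=> t; rewrite /circle.
apply: (@cvgM _ _ _ _ (cst r%:C%C) (fun t => (cos t +i* sin t)%C)).
  exact: cvg_cst.
have h : (cos s, sin s) @[s --> t] --> (cos t, sin t).
  apply: (@cvg_pair R R R (nbhs t) (nbhs (cos t)) (nbhs (sin t)) _ _ _ cos sin).
    exact: continuous_cos.
  exact: continuous_sin.
exact: (cvg_comp _ _ h (@continuous_cartesian (cos t, sin t))).
Qed.

(** Every coordinate of a point of [D] lies in a fixed closed square [Q], and the product of [n]
    copies of [Q] is compact and closed, so it contains the closure too. *)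
Lemma bounded_closure_compact n (D : set 'rV[R[i]]_n) :
  bounded_set D -> compact (closure D).
Proof.
move=> [M [Mr MD]].
(* Boundedness supplies a bound only for numbers strictly above [M], hence the added 1. *)
pose m := complex.Re M + 1.
have MmC : M < m%:C%C by rewrite -[M]RRe_real// ltcR ltrDl.
have {MmC}Dm x : D x -> rnorm x <= m by move=> Dx; rewrite -lecR -rnormE; exact: MD MmC x Dx.
pose Q := (fun p : R * R => (p.1 +i* p.2)%C) @` (`[- m, m]%classic `*` `[- m, m]%classic).
have cQ : compact Q.
  apply: continuous_compact; last by apply: compact_setX; exact: segment_compact.
  by apply: continuous_subspaceT; exact: continuous_cartesian.
have cQn : compact [set v : 'rV[R[i]]_n | forall i, Q (v ord0 i)].
  by apply: (@rV_compact R[i] n (fun=> Q)) => i.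
apply: (subclosed_compact _ cQn); first exact: closed_closure.
rewrite closureE; apply: smallest_sub.
  by apply: compact_closed => //; exact: norm_hausdorff.
move=> v Dv i.
have vim : rnorm (v ord0 i) <= m.
  apply: le_trans (Dm _ Dv); apply/ler_addgt0Pr => e e0.
  have : ball (0 : 'rV[R[i]]_n) (rnorm v + e)%:C%C v.
    rewrite -ball_normE /ball_/= sub0r normrN rnormE ltcR ltrDl//.
  move=> [_ /(_ ord0 i)]; rewrite mxE -ball_normE /ball_/= sub0r normrN rnormE ltcR.
  exact: ltW.
have m0 : 0 <= m by exact: le_trans (rnorm_ge0 _) vim.
have le_m (a b : R) : a ^+ 2 + b ^+ 2 <= m ^+ 2 -> - m <= a <= m.
  move=> abm; rewrite -ler_norml -ler_sqr ?nnegrE// real_normK ?num_real//.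
  by apply: le_trans abm; rewrite lerDl sqr_ge0.
have : rnorm (v ord0 i) ^+ 2 <= m ^+ 2 by rewrite ler_sqr ?nnegrE// rnorm_ge0.
rewrite rnorm_sqr; case: (v ord0 i) => a b /= abm.
exists (a, b) => //; split; rewrite /= in_itv/=; first exact: le_m abm.
by apply: (le_m b a); rewrite addrC.
Qed.

Lemma integral_trig (a b c : R) :
  (\int[lebesgue_measure]_(t in `[0%R, (2 * pi)%R]) (a + b * cos t + c * sin t)%:E
   = (2 * pi * a)%:E)%E.
Proof.
have pi2 : (0 : R) < 2 * pi by rewrite mulr_gt0 ?pi_gt0.
pose F (t : R) := a * t + b * sin t - c * cos t.
have dF (t : R) : is_derive t 1 F (a + b * cos t + c * sin t).
  apply: is_derive_eq.
  by rewrite /GRing.scale/= !mulr1 mulrN opprK.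
have cF : continuous F.
  by move=> t; apply/differentiable_continuous/derivable1_diffP; case: (dF t).
rewrite (@continuous_FTC2 _ _ F)//.
- rewrite /F !mulr0 sin0 cos0 [2 * pi]mulr_natl sin2pi cos2pi !mulr0 mulr1 !addr0 add0r.
  by rewrite -EFinB opprK subrK mulrC.
- apply: continuous_subspaceT => t; apply: cvgD.
    apply: cvgD; first exact: cvg_cst.
    by apply: cvgM; [exact: cvg_cst|exact: continuous_cos].
  by apply: cvgM; [exact: cvg_cst|exact: continuous_sin].
- split.
  + by move=> t _; case: (dF t).
  + by apply: cvg_at_right_filter; exact: cF.
  + by apply: cvg_at_left_filter; exact: cF.
- by move=> t _; rewrite derive1E derive_val.
Qed.

(** On the circle the squared norm is the right-hand constant plus multiples of [cos t] and [sin t],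
    which integrate to zero. The surplus over the value at the centre is what makes the maximum
    principle strict. *)
Lemma circle_mean_normsqr (A B z : R[i]) r :
  circle_mean (fun l => (rnorm (A + l * B) ^+ 2)%:E) z r =
  (rnorm (A + z * B) ^+ 2 + r ^+ 2 * rnorm B ^+ 2)%:E.
Proof.
have pi2 : (0 : R) < 2 * pi by rewrite mulr_gt0 ?pi_gt0.
pose P := A + z * B.
pose p1 := complex.Re P; pose p2 := complex.Im P.
pose b1 := complex.Re B; pose b2 := complex.Im B.
rewrite /circle_mean.
under eq_integral => t _.
  rewrite (_ : rnorm _ ^+ 2 = (rnorm P ^+ 2 + r ^+ 2 * rnorm B ^+ 2) +
    (2 * r * (p1 * b1 + p2 * b2)) * cos t + (2 * r * (p2 * b1 - p1 * b2)) * sin t).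
    over.
  rewrite mulrDl addrA -/P !rnorm_sqr -/p1 -/p2 -/b1 -/b2.
  have := cos2Dsin2 t; rewrite /p1 /p2 /b1 /b2.
  case: (P) => x y; case: (B) => u v /= cs.
  apply/eqP; rewrite -subr_eq0; apply/eqP.
  transitivity (r ^+ 2 * (u ^+ 2 + v ^+ 2) * (cos t ^+ 2 + sin t ^+ 2 - 1)); first ring.
  by rewrite cs subrr mulr0.
rewrite integral_trig -EFinM; congr EFin.
by rewrite mulKf// gt_eqF.
Qed.
End complex_plane.

(** * Plurisubharmonic functions *)

Section psh_functions.
Context {R : realType} {n : nat}.
Implicit Types (Omega : set 'rV[R[i]]_n) (u : 'rV[R[i]]_n -> R).

Lemma rnormZ {V : normedModType R[i]} (l : R[i]) (x : V) :
  rnorm (l *: x) = rnorm l * rnorm x.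
Proof. by apply: complexI; rewrite rmorphM/= -!rnormE normrZ. Qed.

Lemma continuous_rnorm {V : pseudoMetricNormedZmodType R[i]} :
  continuous (@rnorm R V).
Proof.
have le_rnormB (x y : V) : rnorm x - rnorm y <= rnorm (x - y).
  by rewrite lerBlDr -[x in leLHS](subrK y) rnorm_triangle.
apply: continuous_rnorm_le => x y.
by rewrite ler_norml le_rnormB andbT lerNl opprB rnormB.
Qed.

Lemma usc_continuous {T : topologicalType} (D : set T) (f : T -> R) :
  (forall x, D x -> {for x, continuous f}) -> usc_on D (EFin \o f).
Proof.
move=> cf x Dx a xa; apply: cvg_within.
have fa : nbhs (f x) [set r : R | (r%:E < a)%E].
  by apply: open_nbhs_nbhs; split => //; exact: open_ereal_lt.
exact: (cf x Dx _ fa).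
Qed.

Lemma psh_continuous_at Omega u x : open Omega -> psh_continuous Omega u ->
  Omega x -> {for x, continuous u}.
Proof.
move=> oO [_ /(continuous_subspaceW (@subset_closure _ _))].
by rewrite continuous_open_subspace// => cu Ox; apply: cu; rewrite inE.
Qed.

Lemma psh_submean Omega u x (b : 'rV[R[i]]_n) r : psh_continuous Omega u ->
  0 < r -> (forall l : R[i], rnorm l <= r -> Omega (x + l *: b)) ->
  ((u x)%:E <= ((2 * pi)^-1)%:E *
    \int[lebesgue_measure]_(t in `[0%R, (2 * pi)%R]) (u (x + circle r t *: b))%:E)%E.
Proof.
move=> [[_ _ /(_ x b)[_ _ /(_ 0 r) sm]] _] r0 disc.
have := sm r0; rewrite /= scale0r addr0.
have -> : circle_mean (fun l => (u (x + l *: b))%:E) 0 r =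
    (((2 * pi)^-1)%:E * \int[lebesgue_measure]_(t in `[0%R, (2 * pi)%R])
      (u (x + circle r t *: b))%:E)%E.
  by rewrite /circle_mean; under eq_integral do rewrite add0r.
by apply=> l /=; rewrite subr0 rnormE lecR; exact: disc.
Qed.

Lemma continuous_normsqr (k : 'I_n) :
  continuous (fun z : 'rV[R[i]]_n => rnorm (z ord0 k) ^+ 2).
Proof.
move=> z; rewrite /continuous_at /=.
have h : rnorm (w ord0 k) @[w --> z] --> rnorm (z ord0 k).
  exact: (cvg_comp _ _ (@coord_continuous R[i] _ _ ord0 k z) (@continuous_rnorm _ (z ord0 k))).
exact: (cvg_comp _ _ h (@exprn_continuous R 2 (rnorm (z ord0 k)))).
Qed.

Lemma continuous_line (a b : 'rV[R[i]]_n) : continuous (fun l : R[i] => a + l *: b).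
Proof.
move=> l; apply: cvg_rnorm => e e0; apply/nbhs_rnormP.
have b1 : 0 < rnorm b + 1 by rewrite ltr_wpDl// rnorm_ge0.
exists (e / (rnorm b + 1)); first by rewrite divr_gt0.
move=> k; rewrite ltr_pdivlMr// => lk.
rewrite opprD addrACA subrr add0r -scalerBl rnormZ (le_lt_trans _ lk)//.
by rewrite ler_wpM2l ?rnorm_ge0// lerDl.
Qed.

(** On a circle of radius [r] in direction [b] the mean exceeds the value at the centre by [r ^+ 2]
    times the squared modulus of the [k]-th coordinate of [b]. *)
Lemma psh_normsqr (k : 'I_n) Omega :
  psh_continuous Omega (fun z => rnorm (z ord0 k) ^+ 2).
Proof.
split; last by apply: continuous_subspaceT; exact: continuous_normsqr.
split=> [z _| |a b]; first exact: ltry.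
  by apply: usc_continuous => z _; exact: continuous_normsqr.
split=> [z _| |z r r0 _]; first exact: ltry.
  apply: (@usc_continuous R[i] _ (fun l => rnorm ((a + l *: b) ord0 k) ^+ 2)) => l _.
  exact: (cvg_comp _ _ (continuous_line a b l)
    (continuous_normsqr k (a + l *: b))).
have -> : (fun l => (EFin \o (fun z : 'rV[R[i]]_n => rnorm (z ord0 k) ^+ 2)) (a + l *: b))
    = (fun l => (rnorm (a ord0 k + l * b ord0 k) ^+ 2)%:E).
  by apply/funext => l /=; rewrite !mxE.
by rewrite circle_mean_normsqr /= lee_fin !mxE lerDl mulr_ge0 ?sqr_ge0.
Qed.

Lemma integrable_circle (f : R -> R) : continuous f ->
  lebesgue_measure.-integrable `[0, 2 * pi]%classic (EFin \o f).
Proof.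
move=> cf; apply: continuous_compact_integrable; first exact: segment_compact.
exact: continuous_subspaceT.
Qed.

(* [u + |z_k|^2] is strictly plurisubharmonic along the [k]-th axis: on small
   circles its mean exceeds its value at the centre by at least [r ^+ 2]. *)
Lemma psh_strict_max Omega u (k : 'I_n) z M : open Omega ->
  psh_continuous Omega u -> Omega z ->
  (forall y, Omega y -> u y + rnorm (y ord0 k) ^+ 2 <= M) ->
  u z + rnorm (z ord0 k) ^+ 2 < M.
Proof.
(* Along this direction the [k]-th coordinate itself runs over a circle of radius [r], so the mean
   gains exactly [r ^+ 2]. *)
move=> oO pu Oz uM; pose b : 'rV[R[i]]_n := delta_mx ord0 k.
have /nbhs_rnormP[e e0 eO] : nbhs (0 : R[i]) ((fun l => z + l *: b) @^-1` Omega).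
  apply: continuous_line; apply: open_nbhs_nbhs; split => //=.
  by rewrite scale0r addr0.
have disc (l : R[i]) : rnorm l <= e / 2 -> Omega (z + l *: b).
  move=> le2; apply: eO; rewrite sub0r /rnorm normrN (le_lt_trans le2)//.
  by rewrite ltr_pdivrMr// ltr_pMr// ltr1n.
have r0 : 0 < e / 2 by rewrite divr_gt0.
move: (e / 2) r0 disc => r r0 disc {e e0 eO}.
have Oc t : Omega (z + circle r t *: b) by apply: disc; rewrite rnorm_circle// ltW.
have cc : continuous (fun t => z + circle r t *: b).
  move=> t; apply: (@continuous_comp _ _ _ (circle r) (fun l => z + l *: b)).
    exact: continuous_circle.
  exact: continuous_line.
pose f t := u (z + circle r t *: b).
pose q t := rnorm ((z + circle r t *: b) ord0 k) ^+ 2.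
have cf : continuous f.
  move=> t; apply: (@continuous_comp _ _ _ (fun t => z + circle r t *: b) u).
    exact: cc.
  exact: (psh_continuous_at Omega).
have cq : continuous q.
  move=> t; apply: (@continuous_comp _ _ _ (fun t => z + circle r t *: b)
    (fun z => rnorm (z ord0 k) ^+ 2)).
    exact: cc.
  exact: continuous_normsqr.
have ifq := integrable_circle f cf; have iq := integrable_circle q cq.
have pi2 : (0 : R) < 2 * pi by rewrite mulr_gt0 ?pi_gt0.
have pi2E : (0 <= ((2 * pi)^-1)%:E :> \bar R)%E by rewrite lee_fin invr_ge0 ltW.
have uf := psh_submean Omega u z b r pu r0 disc.
have qE : (((2 * pi)^-1)%:E *
    \int[lebesgue_measure]_(t in `[0%R, (2 * pi)%R]) (q t)%:E)%E =
    (rnorm (z ord0 k) ^+ 2 + r ^+ 2)%:E.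
  have := circle_mean_normsqr (z ord0 k) (b ord0 k) 0 r.
  rewrite /circle_mean mul0r addr0 [b _ _]mxE !eqxx/=.
  rewrite (_ : rnorm (1 : R[i]) = 1) ?expr1n ?mulr1; last by rewrite /rnorm normr1.
  move=> <-; congr (_ * _)%E; apply: eq_integral => t _.
  by rewrite /q !mxE !eqxx/= !mulr1 add0r.
(* The bound by [M] is averaged over the circle. The submean inequality for [u] and the exact mean
   of [q] then give [u z + q + r ^+ 2 <= M], with [q] taken at the centre. *)
have : (((2 * pi)^-1)%:E * \int[lebesgue_measure]_(t in `[0%R, (2 * pi)%R])
    ((f t)%:E + (q t)%:E) <= M%:E)%E.
  apply: (@le_trans _ _ (((2 * pi)^-1)%:E *
    \int[lebesgue_measure]_(t in `[0%R, (2 * pi)%R]) (cst M%:E t))%E).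
    rewrite lee_wpmul2l//; apply: le_integral => //.
    - exact: (integrableD _ ifq iq).
    - by apply: (@integrable_circle (cst M)); exact: cst_continuous.
    - by move=> t _; rewrite /cst/= lee_fin; exact: uM.
  rewrite integral_cst//= lebesgue_measure_itv/= lte_fin pi2 sube0.
  change (((2 * pi)^-1 * (M * (2 * pi)))%:E <= M%:E)%E.
  by rewrite lee_fin mulrCA mulVf ?mulr1// gt_eqF.
rewrite integralD// muleDr//; last first.
  by rewrite fin_num_adde_defl// (integrable_fin_num _ iq).
rewrite qE => /(le_trans (leeD2r _ uf)); rewrite -EFinD lee_fin.
by apply: lt_le_trans; rewrite addrA ltrDl exprn_gt0.
Qed.

End psh_functions.

(** * Measures carried by the boundary *)

Lemma continuous_opp (R : realType) (T : topologicalType) (f : T -> R) :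
  continuous f -> continuous (fun x => - f x).
Proof. by move=> cf x; apply: cvgN; exact: cf. Qed.

Lemma continuous_add (R : realType) (T : topologicalType) (f g : T -> R) :
  continuous f -> continuous g -> continuous (fun x => f x + g x).
Proof. by move=> cf cg x; apply: cvgD; [exact: cf|exact: cg]. Qed.

Lemma integral_oppr (R : realType) d (T : measurableType d) (m : {measure set T -> \bar R})
    (D : set T) (f : T -> R) : measurable D -> m.-integrable D (EFin \o f) ->
  (\int[m]_(x in D) (- f x)%:E = - \int[m]_(x in D) (f x)%:E)%E.
Proof.
move=> mD intf; rewrite -integralN; last by apply: integrable_add_def.
by apply: eq_integral => x _; rewrite EFinN.
Qed.

Section radon_measures.
Context {R : realType} {n : nat}.
Local Notation Cn := ('rV[R[i]]_n).
Implicit Types (mu nu : {measure set (borelCn R n) -> \bar R}) (X Omega : set Cn).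

Lemma perfectly_normal_Cn : perfectly_normal R Cn.
Proof. exact: perfectly_normal_complex. Qed.

Lemma compact_Cn_measurable X : compact X -> measurable (X : set (borelCn R n)).
Proof.
by move=> cX; apply: closed_borel; apply: compact_closed.
Qed.

Lemma radon_finite X mu : compact X -> radon_on X mu -> (mu setT < +oo)%E.
Proof.
move=> cX [muX /(_ X cX) mufin _]; have mX := compact_Cn_measurable X cX.
rewrite -(setvU X); apply: le_lt_trans (measureU2 _ _ _) _ => //.
  exact: measurableC.
by rewrite [X in (X + _)%E]muX add0e.
Qed.

(** Each point off the support has a null open neighbourhood, but there may be uncountably many of
    these. Inner regularity reduces to compact sets, which finitely many of them cover. *)
Lemma radon_disjoint_msupport X Omega mu : radon_on X mu -> open Omega ->
  (forall z, Omega z -> ~ msupport mu z) -> mu Omega = 0%E.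
Proof.
move=> [_ _ regmu] oO nsupp.
rewrite regmu; last exact: open_borel.
apply/eqP; rewrite eq_le; apply/andP; split; last first.
  by apply: ereal_sup_ubound; exists set0; rewrite ?measure0//; split => //; exact: compact0.
apply: ge_ereal_sup => _ [K [cK KO] <-].
pose D := [set U : set Cn | open U /\ mu U = 0%E].
have [D' D'D KD] : finite_subset_cover D id K.
  have : cover_compact K by rewrite -compact_cover.
  apply=> [U []//|z Kz].
  have /existsNP[U /not_implyP[oU /not_implyP[Uz muU]]] := nsupp z (KO z Kz).
  exists U => //; split=> //; apply/eqP.
  by rewrite eq_le measure_ge0 andbT leNgt; exact/negP.
have [mB B0] : measurable (\bigcup_(U in [set` D']) U : set (borelCn R n)) /\
    mu (\bigcup_(U in [set` D']) U) = 0%E.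
  rewrite bigcup_fset big_seq; apply: (big_ind (fun B : set (borelCn R n) =>
    measurable B /\ mu B = 0%E)).
  - by rewrite measure0.
  - move=> A B [mA A0] [mB B0]; split; first exact: measurableU.
    by rewrite null_set_setU.
  - by move=> U /D'D /set_mem[oU U0]; split => //; exact: open_borel.
rewrite -B0; apply: le_measure => //; apply/mem_set => //.
exact: compact_Cn_measurable.
Qed.

Lemma integrable_within X mu (u : Cn -> R) : compact X -> (mu setT < +oo)%E ->
  {within X, continuous u} -> mu.-integrable X (EFin \o u).
Proof.
move=> cX muT cu; have mX := compact_Cn_measurable X cX.
apply: measurable_bounded_integrable => //.
- by apply: le_lt_trans muT; apply: le_measure => //; apply/mem_set.
- exact: continuous_within_borel.
- have /compact_bounded := continuous_compact cu cX.
  move=> [M [Mr MP]]; exists M; split => // x Mx y Xy.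
  by apply: (MP x Mx); exists y.
Qed.

Lemma integral_boundary Omega mu (f : Cn -> R) : open Omega ->
  compact (closure Omega) -> (mu setT < +oo)%E -> mu Omega = 0%E ->
  {within closure Omega, continuous f} ->
  (\int[mu]_(z in closure Omega) (f z)%:E = \int[mu]_(z in boundary Omega) (f z)%:E)%E.
Proof.
move=> oO cO muT muO cf.
rewrite /boundary (interior_id _).1//.
apply: negligible_integral => //.
- exact: open_borel.
- exact: compact_Cn_measurable.
- exact: integrable_within.
Qed.

Lemma le_c_interior_null Omega mu nu : (0 < n)%N -> B_regular Omega ->
  (mu setT < +oo)%E -> (nu setT < +oo)%E -> mu Omega = 0%E ->
  le_c Omega nu mu -> nu Omega = 0%E.
Proof.
move=> n0 [[Ox0 oO _] bO reg] muT nuT muO le_numu.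
have cO := bounded_closure_compact n Omega bO.
have mO := compact_Cn_measurable _ cO.
have iO : Omega^° = Omega by exact: (interior_id _).1.
pose k := Ordinal n0; pose q (z : Cn) := rnorm (z ord0 k) ^+ 2.
have pq : psh_continuous Omega q := psh_normsqr k Omega.
have cNq : continuous (fun z => - q z).
  exact: (continuous_opp _ _ _ (continuous_normsqr k)).
have [u pu ubd] := reg _ (continuous_subspaceT cNq).
pose v z := u z + q z.
have cv : {within closure Omega, continuous v}.
  exact: (continuous_add _ _ _ _ pu.2 pq.2).
have vbd z : boundary Omega z -> v z = 0 by move=> bz; rewrite /v ubd// addNr.
have Obd z : closure Omega z -> ~ Omega z -> boundary Omega z by rewrite /boundary iO.
(* The maximum of [v] over the compact closure is attained at some [c]. By the strict maximum
   principle [c] is not in [Omega], so the maximum is the boundary value 0 and is not reached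
   inside. *)
have v0 z : Omega z -> v z < 0.
  have [|c /set_mem Xc cmax] := compact_EVT_max _ cO cv.
    by case: Ox0 => x Ox; exists x; exact: subset_closure.
  have vmax y : Omega y -> v y < v c.
    move=> Oy; apply: (psh_strict_max Omega u k y) => // x Ox.
    by apply/cmax/mem_set; exact: subset_closure.
  have [Oc|Oc] := pselect (Omega c); first by have := vmax c Oc; rewrite ltxx.
  by rewrite -(vbd c (Obd c Xc Oc)); exact: vmax.
have iu (m : {measure set (borelCn R n) -> \bar R}) :
    (m setT < +oo)%E -> m.-integrable (closure Omega) (EFin \o u).
  by move=> mT; apply: integrable_within => //; exact: pu.2.
have iq (m : {measure set (borelCn R n) -> \bar R}) :
  (m setT < +oo)%E -> m.-integrable (closure Omega) (EFin \o q).
  by move=> mT; apply: integrable_within => //; exact: pq.2.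
have vle0 z : closure Omega z -> v z <= 0.
  move=> Xz; have [Oz|Oz] := pselect (Omega z); first exact/ltW/v0.
  by rewrite vbd//; exact: Obd.
have muv : (\int[mu]_(z in closure Omega) (v z)%:E = 0)%E.
  rewrite integral_boundary//; apply: integral0_eq => z /vbd ->//.
(* The order is applied to [u] and to [q] separately, and the two inequalities are added. *)
have nuv : (0 <= \int[nu]_(z in closure Omega) (v z)%:E)%E.
  rewrite -muv /v; under eq_integral do rewrite EFinD.
  under [leRHS]eq_integral do rewrite EFinD.
  rewrite !integralD//; try exact: iu; try exact: iq.
  by apply: leeD; exact: le_numu.
(* Since [v <= 0] has nonnegative integral, it vanishes [nu]-almost everywhere; but it is nonzero at
   every point of [Omega]. *)
have : (\int[nu]_(z in closure Omega) `|(v z)%:E| = 0)%E.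
  apply/eqP; rewrite eq_le integral_ge0// andbT.
  under eq_integral => z /set_mem Xz do rewrite /= ler0_norm ?vle0//.
  rewrite integral_oppr// ?oppe_le0//.
  exact: integrable_within.
move/(ae_eq_integral_abs nu mO _).1 => /(_ _)[|N [mN N0 NP]].
  by apply/measurable_EFinP; exact: continuous_within_borel.
apply: (subset_measure0 _ mN _ N0); first exact: open_borel.
move=> z Oz; apply: NP => /= /(_ (subset_closure Oz))[vz].
by have := v0 z Oz; rewrite vz ltxx.
Qed.

Lemma boundary_supported_minimal Omega mu : (0 < n)%N -> B_regular Omega ->
  radon_on (closure Omega) mu -> msupport mu `<=` boundary Omega ->
  minimal_c Omega mu.
Proof.
move=> n0 regO rmu supp nu rnu le_numu.
have [[_ oO _] bO reg] := regO.
have cO := bounded_closure_compact n Omega bO.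
have muT := radon_finite _ _ cO rmu; have nuT := radon_finite _ _ cO rnu.
have iO : Omega^° = Omega by exact: (interior_id _).1.
have muO : mu Omega = 0%E.
  apply: (radon_disjoint_msupport _ _ _ rmu oO) => z Oz /supp[_].
  by rewrite iO.
have nuO := le_c_interior_null _ _ _ n0 regO muT nuT muO le_numu.
have mbd : measurable (boundary Omega : set (borelCn R n)).
  rewrite /boundary iO; apply: measurableD; first exact: compact_Cn_measurable.
  exact: open_borel.
have cbd : closed (boundary Omega).
  by rewrite /boundary iO setDE; apply: closedI; [exact: closed_closure|exact: open_closedC].
have eq_bd (f : Cn -> R) : continuous f ->
    (\int[mu]_(z in boundary Omega) (f z)%:E =
     \int[nu]_(z in boundary Omega) (f z)%:E)%E.
  (* Neither measure charges [Omega], so the integral of [g] over the boundary is that of its psh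
     extension over the closure. The reverse inequality comes from the same bound for [- f]. *)
  have le_bd (g : Cn -> R) : continuous g ->
    (\int[mu]_(z in boundary Omega) (g z)%:E <=
     \int[nu]_(z in boundary Omega) (g z)%:E)%E.
    move=> cg; have [u pu ug] := reg g (continuous_subspaceT cg).
    have ubd (m : {measure set (borelCn R n) -> \bar R}) :
        (m setT < +oo)%E -> m Omega = 0%E ->
        (\int[m]_(z in boundary Omega) (g z)%:E =
         \int[m]_(z in closure Omega) (u z)%:E)%E.
      move=> mT mO; rewrite integral_boundary//; last exact: pu.2.
      by apply: eq_integral => z /set_mem bz; rewrite ug.
    by rewrite !ubd//; exact: le_numu.
  move=> cf; apply/eqP; rewrite eq_le le_bd//=.
  have cNf := continuous_opp _ _ _ cf.
  have ibd (m : {measure set (borelCn R n) -> \bar R}) : (m setT < +oo)%E ->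
      m.-integrable (boundary Omega) (EFin \o f).
    move=> mT; apply: integrable_within => //; last exact: continuous_subspaceT.
    by apply: (subclosed_compact cbd cO) => z [].
  have := le_bd _ cNf.
  rewrite !integral_oppr ?leeN2//; exact: ibd.
have eq_closed (F : set Cn) : closed F -> F `<=` boundary Omega -> mu F = nu F.
  move=> cF Fbd; apply/eqP; rewrite eq_le.
  apply/andP; split; apply: (le_measure_closed perfectly_normal_Cn _ _ (boundary Omega)) => //.
  - by move=> f cf _; rewrite eq_bd.
  - by move=> f cf _; rewrite eq_bd.
have eq_compact (K : set Cn) : compact K -> nu K = mu K.
  move=> cK; have mK := compact_Cn_measurable _ cK.
  (* The part of [K] off the boundary lies in [Omega] or outside the closure, both null; only the
     closed set [K] cut with the boundary counts. *)
  have bd_part (m : {measure set (borelCn R n) -> \bar R}) :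
      m (~` closure Omega) = 0%E -> m Omega = 0%E ->
      m K = m (K `&` boundary Omega).
    move=> mX mO.
    have -> : m K = (m ((K : set (borelCn R n)) `\` boundary Omega) + m (K `&` boundary Omega))%E.
      exact: measureDI.
    rewrite (@subset_measure0 _ _ _ m _ (~` closure Omega `|` Omega)) ?add0e//.
    - exact: measurableD.
    - apply: measurableU; last exact: open_borel.
      by apply: measurableC; exact: compact_Cn_measurable.
    - move=> z [_ bz]; have [Xz|] := pselect (closure Omega z); last by left.
      by right; apply: contrapT => Oz; apply: bz; rewrite /boundary iO.
    - apply: null_set_setU => //; last exact: open_borel.
      by apply: measurableC; exact: compact_Cn_measurable.
  case: (rmu) (rnu) => mu0 _ _ [nu0 _ _].
  rewrite !bd_part//; apply/esym/eq_closed; last by move=> z [].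
  by apply: closedI => //; apply: compact_closed => //; exact: norm_hausdorff.
case: rmu rnu => _ _ regmu [_ _ regnu] A mA.
rewrite regmu// regnu//; congr ereal_sup.
by apply/seteqP; split=> _ [K KP <-]; exists K => //; rewrite eq_compact//; case: KP.
Qed.
End radon_measures.

(** * Sweeping along circles *)

(** The measure structure of a pushforward depends on the proof that [f] is measurable; the
    existential hides it and keeps only the values. *)
Lemma image_measure (R : realType) d d' (T1 : measurableType d) (T2 : measurableType d')
    (m : {measure set T1 -> \bar R}) (f : T1 -> T2) : measurable_fun setT f ->
  exists nu : {measure set T2 -> \bar R},
    nu = pushforward m f :> (set T2 -> \bar R).
Proof.
by move=> mf; unshelve eexists;
  [refine (pushforward m f : {measure set T2 -> \bar R})|].
Qed.

Section sweeping.
Context {R : realType} {n : nat}.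
Local Notation Cn := ('rV[R[i]]_n).
Local Notation borelCn := (borelCn R n).
Implicit Types (mu nu : {measure set borelCn -> \bar R}) (B Omega : set Cn).

(** With [x] distributed by [mu] and [t] uniform on [[0, 2 * pi]], the law of the result is [mu]
    with its part on [B] averaged over circles, an elementary form of balayage. *)
Definition sweep B (r : R) (b : Cn) (x : Cn) (t : R) : Cn :=
  if x \in B then x + circle r t *: b else x.

(** The map may jump in [x] across the edge of [B], but it is Borel in [x] and continuous in [t],
    which suffices for joint measurability. *)
Lemma sweep_measurable B r b : open B ->
  measurable_fun setT (fun p : borelCn * R => sweep B r b p.1 p.2 : borelCn).
Proof.
move=> oB; apply: (@caratheodory_measurable R Cn _ borelCn (sweep B r b)).
- exact: perfectly_normal_Cn.
- move=> t; apply: (@measurability _ _ _ borelCn _ _ (@open Cn) erefl) => _ [U oU <-].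
  have oV : open ((fun x : Cn => x + circle r t *: b) @^-1` U).
    have /continuousP : continuous (fun x : Cn => x + circle r t *: b).
      move=> x; apply: cvg_rnorm => e e0; apply/nbhs_rnormP; exists e => // y.
      by rewrite opprD addrACA subrr addr0.
    exact.
  rewrite setTI (_ : _ @^-1` U =
    B `&` ((fun x : Cn => x + circle r t *: b) @^-1` U) `|` ~` B `&` U).
    apply: measurableU; apply: measurableI; try exact: open_borel.
    by apply: measurableC; exact: open_borel.
  apply/seteqP; split=> x; rewrite /sweep /=.
    by case: ifPn => [/set_mem|/negP Bn]; [left|right; split => // Bx; exact/Bn/mem_set].
  by case=> -[Bx Ux]; [rewrite (mem_set Bx)|rewrite (memNset Bx)].
- move=> x; rewrite /sweep; have [_|_] := boolP (x \in B); last exact: cst_continuous.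
  move=> t.
  exact: (cvg_comp _ _ (@continuous_circle R r t) (continuous_line x b _)).
Qed.

Lemma not_minimal_interior Omega mu z : (0 < n)%N -> open Omega ->
  compact (closure Omega) -> radon_on (closure Omega) mu -> minimal_c Omega mu ->
  msupport mu z -> ~ Omega z.
Proof.
move=> n0 oO cO rmu minmu supz Oz.
have muT := radon_finite _ _ cO rmu.
have mX := compact_Cn_measurable _ cO.
pose b : Cn := delta_mx ord0 (Ordinal n0).
have b0 : 0 < rnorm b.
  rewrite lt_def rnorm_ge0 andbT; apply/eqP => bn0.
  have /eqP : `|b| = 0 by rewrite rnormE bn0.
  rewrite normr_eq0 => /eqP/matrixP/(_ ord0 (Ordinal n0)).
  by rewrite !mxE !eqxx/= => /eqP; rewrite oner_eq0.
have /nbhs_rnormP[e e0 eO] : nbhs z Omega by exact: open_nbhs_nbhs.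
(* Points of [B] are moved by exactly [2 * d]. They stay within [3 * d < e] of [z], hence in
   [Omega], and they leave [B], whose points are less than [2 * d] apart. *)
pose d := e / 4; pose r := 2 * d / rnorm b.
have d0 : 0 < d by rewrite divr_gt0.
have r0 : 0 < r by rewrite divr_gt0// mulr_gt0.
pose B : set Cn := [set x | rnorm (z - x) < d].
have oB : open B.
  have /continuousP : continuous (fun x : Cn => rnorm (z - x)).
    have zle (x y : Cn) : rnorm (z - x) - rnorm (z - y) <= rnorm (x - y).
      by rewrite lerBlDr [leRHS]addrC (rnormB x y) rnorm_dist.
    apply: continuous_rnorm_le => x y.
    by rewrite ler_norml zle andbT lerNl opprB (rnormB x y) zle.
  by move=> /(_ [set y | y < d]); apply; exact: open_lt.
have disc x (l : R[i]) : B x -> rnorm l <= r -> Omega (x + l *: b).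
  move=> Bx lr; apply: eO; rewrite opprD addrA.
  apply: (le_lt_trans (rnorm_triangle _ _)).
  rewrite rnormN rnormZ.
  have : rnorm l * rnorm b <= 2 * d.
    by rewrite -ler_pdivlMr.
  move: Bx; rewrite /B /= /d; lra.
have BO : B `<=` Omega.
  by move=> x Bx; rewrite -[x]addr0 -(scale0r b); apply: disc => //; rewrite /rnorm normr0 ltW.
have out x t : B x -> ~ B (x + circle r t *: b).
  move=> Bx; rewrite /B /= => Bxt.
  have : rnorm (circle r t *: b) = 2 * d.
    by rewrite rnormZ rnorm_circle ?ltW// /r divfK// gt_eqF.
  have wE : (z - x) - (z - (x + circle r t *: b)) = circle r t *: b.
    by rewrite opprB addrC addrA subrK [x + _]addrC addrK.
  have := rnorm_triangle (z - x) (- (z - (x + circle r t *: b))).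
  rewrite wE rnormN; move: Bx Bxt; rewrite /B /=; lra.
pose f (p : borelCn * R) : borelCn := sweep B r b p.1 p.2.
have mf : measurable_fun setT f by exact: sweep_measurable.
have mB : measurable (B : set borelCn) by exact: open_borel.
have pi2 : (0 : R) < 2 * pi by rewrite mulr_gt0 ?pi_gt0.
pose m : {finite_measure set borelCn -> \bar R} := mfrestr measurableT muT.
have mE A : m A = mu A by rewrite /m /= /mfrestr /mrestr setIT.
pose P : probability _ R := uniform_prob pi2.
have [nu nuE] := image_measure _ _ _ _ _ (m \x P)%E f mf.
(* Sweeping maps the closure into itself and fixes every point outside, so [nu] and [mu] give equal
   mass to the closure and to its complement. *)
have fX : f @^-1` closure Omega = closure Omega `*` setT.
  apply/seteqP; split=> -[x t]; rewrite /f /sweep /=.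
    by case: ifPn => [/set_mem/BO Ox _|_ //]; split => //; exact: subset_closure.
  move=> [Xx _]; have [/set_mem Bx|_] := boolP (x \in B); last exact: Xx.
  apply: subset_closure; apply: (disc _ _ Bx).
  by rewrite rnorm_circle ?lexx// ltW.
have prodE (A : set borelCn) : measurable A -> (m \x P)%E (A `*` setT) = mu A.
  move=> mA; transitivity (m A * P setT)%E.
    by apply: product_measure1E => //; exact: measurableT.
  by rewrite probability_setT mule1 mE.
have nuX : nu (closure Omega) = mu (closure Omega).
  by rewrite nuE /pushforward fX; exact: prodE.
have nu0 : nu (~` closure Omega) = 0%E.
  rewrite nuE /pushforward -preimage_setC fX.
  rewrite (_ : ~` _ = ~` closure Omega `*` setT); last first.
    by apply/seteqP; split=> -[x t] /=; tauto.
  by case: rmu => <- _ _; apply: prodE; exact: measurableC.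
have nuT : (nu setT < +oo)%E.
  rewrite (_ : nu setT = mu setT)// nuE /pushforward.
  rewrite (_ : _ @^-1` _ = setT `*` setT); last by apply/seteqP; split.
  exact: prodE.
have nuB : nu B = 0%E.
  rewrite nuE /pushforward (_ : _ @^-1` _ = set0) ?measure0//.
  apply/seteqP; split=> // -[x t]; rewrite /f /sweep /=.
  by case: ifPn => [/set_mem/out|/negP Bn Bx]; [exact|apply: Bn; exact/mem_set].
have rnu : radon_on (closure Omega) nu.
  split=> //.
    move=> K cK; apply: le_lt_trans nuT; apply: le_measure => //; apply/mem_set => //.
    exact: compact_Cn_measurable.
  exact: (finite_borel_inner_regular perfectly_normal_Cn nu (closure Omega)).
suff le_numu : le_c Omega nu mu.
  have Bz : B z by rewrite /B /= subrr /rnorm normr0.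
  by have := supz B oB Bz; rewrite -(minmu nu rnu le_numu B mB) nuB ltxx.
move=> u pu; have cu := pu.2.
have iu (m' : {measure set borelCn -> \bar R}) : (m' setT < +oo)%E ->
    m'.-integrable (closure Omega) (EFin \o u).
  by move=> m'T; exact: integrable_within.
have [c0 c0X cmin] := compact_EVT_min (ex_intro _ z (subset_closure Oz)) cO cu.
(* Adding [C] makes the integrand nonnegative, as Tonelli requires. The constant cancels at the end
   because both measures have the same finite mass on the closure. *)
pose C := - u c0.
have uC x : closure Omega x -> 0 <= u x + C.
  by move=> Xx; rewrite subr_ge0; apply/cmin/mem_set.
pose w : borelCn -> \bar R := (fun x => (u x + C)%:E) \_ (closure Omega).
have wE x : closure Omega x -> w x = (u x + C)%:E by move=> Xx; rewrite /w patchT ?mem_set.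
have w0 x : (0 <= w x)%E.
  by rewrite /w patchE; case: ifPn => // /set_mem Xx; rewrite lee_fin uC.
have mw : measurable_fun setT w.
  apply/(measurable_restrictT _ mX)/measurable_EFinP.
  by apply: measurable_funD => //; exact: continuous_within_borel.
have int_w (m' : {measure set borelCn -> \bar R}) : (m' setT < +oo)%E ->
    (\int[m']_x w x = \int[m']_(x in closure Omega) (u x)%:E + C%:E * m' (closure Omega))%E.
  move=> m'T; rewrite /w -integral_mkcond.
  under eq_integral do rewrite EFinD.
  rewrite integralD//; first by rewrite integral_cst.
  - exact: iu.
  - apply: integrable_within => //.
    by apply: continuous_subspaceT; exact: cst_continuous.
suff le_w : (\int[mu]_x w x <= \int[nu]_x w x)%E.
  move: le_w; rewrite !int_w// nuX leeD2rE//.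
  rewrite fin_numM// ge0_fin_numE// (le_lt_trans _ muT)//.
  by apply: le_measure => //; apply/mem_set.
have mwf : measurable_fun setT (w \o f) by exact: measurableT_comp.
have -> : (\int[nu]_x w x = \int[m]_x \int[P]_t w (sweep B r b x t))%E.
  transitivity (\int[m \x P]_p (w \o f) p)%E.
    by rewrite nuE ge0_integral_pushforward.
  exact: (@fubini_tonelli1 _ _ _ _ R m P (w \o f) mwf (fun p => w0 _)).
have -> : (\int[mu]_x w x = \int[m]_x w x)%E.
  by apply: eq_measure_integral => A _ _; exact: (esym (mE A)).
apply: ge0_le_integral => //.
- exact: (@measurable_fun_fubini_tonelli_F _ _ _ _ R P (w \o f) mwf (fun p => w0 _)).
(* The comparison is now pointwise in [x]: off [B] both sides agree, and on [B] it is the submean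
   inequality for [u] on the circle about [x]. *)
move=> x _; rewrite /sweep.
have [/set_mem Bx|_] := boolP (x \in B); last first.
  by rewrite integral_cst//= probability_setT mule1.
pose g t := u (x + circle r t *: b).
have Oc t : Omega (x + circle r t *: b).
  by apply: (disc _ _ Bx); rewrite rnorm_circle ?lexx// ltW.
have cg : continuous g.
  move=> t; have line_t : {for t, continuous (fun t => x + circle r t *: b)}.
    exact: (cvg_comp _ _ (@continuous_circle R r t) (continuous_line x b _)).
  exact: (cvg_comp _ _ line_t (psh_continuous_at _ _ _ oO pu (Oc t))).
have ug := psh_submean Omega u x b r pu r0 (fun l => disc x l Bx).
have -> : (\int[P]_t w (x + circle r t *: b)%R = \int[P]_t (g t + C)%:E)%E.
  by apply: eq_integral => t _; rewrite wE//; exact: subset_closure.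
rewrite integral_uniform.
- rewrite subr0.
  under eq_integral do rewrite EFinD.
  rewrite integralD//; last 2 first.
  + exact: (integrable_circle g cg).
  + by apply: (integrable_circle (cst C)); exact: cst_continuous.
  rewrite integral_cst//= lebesgue_measure_itv/= lte_fin pi2 sube0.
  rewrite muleDr//; last by rewrite fin_num_adde_defl.
  rewrite wE; last by apply: subset_closure; exact: BO.
  rewrite EFinD; apply: leeD => //.
  change (C%:E <= ((2 * pi)^-1 * (C * (2 * pi)))%:E)%E.
  by rewrite lee_fin mulrCA mulVf ?mulr1// gt_eqF.
- apply/measurable_EFinP; apply: measurable_funD => //.
  exact: continuous_measurable_fun.
- by move=> t; rewrite lee_fin uC//; exact: subset_closure.
Qed.
End sweeping.

Theorem theorem5p5 (R : realType) (n : nat) (n_gt0 : (0 < n)%N)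
    (Omega : set 'rV[R[i]]_n) (Omega_reg : B_regular Omega)
    (mu : {measure set (borelCn R n) -> \bar R})
    (mu_radon : radon_on (closure Omega) mu) :
  minimal_c Omega mu <-> msupport mu `<=` boundary Omega.
Proof.
have [[_ oO _] bO _] := Omega_reg.
have cO := bounded_closure_compact n Omega bO.
split=> [minmu z supz|]; last exact: boundary_supported_minimal.
split; last first.
  rewrite (interior_id _).1//.
  exact: (not_minimal_interior _ _ _ n_gt0 oO cO mu_radon minmu supz).
(* A support point outside the closure would have the complement of the closure as an open
   neighbourhood, which is [mu]-null. *)
apply: contrapT => Xz; have [mu0 _ _] := mu_radon.
have oX : open (~` closure Omega) by apply: closed_openC; exact: closed_closure.
by have := supz _ oX Xz; rewrite mu0 ltxx.
Qed.
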